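(* Let $n\ge 1$, let $|\psi\rangle\in(\mathbb{C}^2)^{\otimes n}$ be a symmetric $n$-qubit pure state, and let $r_{\boldsymbol\alpha}=\frac{1}{2^n}\langle\psi|\sigma_{\boldsymbol\alpha}|\psi\rangle$, $\boldsymbol\alpha\in\{0,1,2,3\}^n$, be the components of its generalized Bloch vector. Then for every even integer $w$ with $0\le w\le n$, the even components $r_{\boldsymbol\alpha}$ of index weight $\omega(\boldsymbol\alpha)=w$ do not all vanish; that is, there exists an even index $\boldsymbol\alpha$ with $\omega(\boldsymbol\alpha)=w$ and $r_{\boldsymbol\alpha}\neq 0$.
   Context: A pure $n$-qubit state is a unit vector $|\psi\rangle\in(\mathbb{C}^2)^{\otimes n}$. It is symmetric if $U_\pi|\psi\rangle=|\psi\rangle$ for every permutation $\pi\in S_n$, where $U_\pi$ is the unitary operator permuting the $n$ tensor factors according to $\pi$. Let $\sigma_0$ be the $2\times2$ identity matrix and $\sigma_1,\sigma_2,\sigma_3$ the usual Pauli matrices. For $\boldsymbol\alpha=(\alpha_1,\dots,\alpha_n)\in\{0,1,2,3\}^n$ put $\sigma_{\boldsymbol\alpha}=\sigma_{\alpha_1}\otimes\cdots\otimes\sigma_{\alpha_n}$. The weight $\omega(\boldsymbol\alpha)$ is the number of positions $i$ with $\alpha_i\ne0$. For $a\in\{1,2,3\}$ let $\lambda_a$ be the number of positions $i$ with $\alpha_i=a$. The index $\boldsymbol\alpha$ (and the component $r_{\boldsymbol\alpha}$) is called even if $\lambda_1,\lambda_2,\lambda_3$ are all even, and odd otherwise. 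*)

(* Defs.v *)
From HB Require Import structures.
From mathcomp Require Import all_boot all_order all_fingroup all_algebra.
From mathcomp Require Import reals complex.
Set Implicit Arguments.
Unset Strict Implicit.
Unset Printing Implicit Defensive.
Import Order.TTheory GRing.Theory Num.Theory.
Local Open Scope ring_scope.

(* (C^2)^{(x) n}, a vector being given by its coefficients in the computational
   basis |x_0> (x) ... (x) |x_{n-1}>, which is indexed by bit strings x. *)
Definition qvec (C : numClosedFieldType) (n : nat) : Type :=
  {ffun {ffun 'I_n -> 'I_2} -> C}.

Section QubitSystems.
Variables (C : numClosedFieldType) (n : nat).
Implicit Types (phi psi : qvec C n) (A : 'I_n -> 'M[C]_2) (s : 'S_n).

Definition tens_vec (v : 'I_n -> 'cV[C]_2) : qvec C n :=
  [ffun x : {ffun 'I_n -> 'I_2} => \prod_(i < n) v i (x i) 0].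

(* A_0 (x) ... (x) A_{n-1}, whose (x, y) matrix entry is
   \prod_i A_i (x_i) (y_i). *)
Definition tens_op A psi : qvec C n :=
  [ffun x : {ffun 'I_n -> 'I_2} =>
     \sum_(y : {ffun 'I_n -> 'I_2}) (\prod_(i < n) A i (x i) (y i)) * psi y].

(* U_s sends (x)_i v_i to (x)_i v_(s^-1 i); see [perm_op_tens]. *)
Definition perm_op s psi : qvec C n :=
  [ffun x : {ffun 'I_n -> 'I_2} => psi [ffun i => x (s i)]].

Lemma tens_op_tens A (v : 'I_n -> 'cV[C]_2) :
  tens_op A (tens_vec v) = tens_vec (fun i => A i *m v i).
Proof.
apply/ffunP=> x; rewrite !ffunE.
under [RHS]eq_bigr do rewrite mxE.
rewrite bigA_distr_bigA /=; apply: eq_bigr => y _.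
by rewrite ffunE -big_split.
Qed.

Lemma perm_op_tens s (v : 'I_n -> 'cV[C]_2) :
  perm_op s (tens_vec v) = tens_vec (fun i => v ((s^-1)%g i)).
Proof.
apply/ffunP=> x; rewrite !ffunE [RHS](reindex_inj (@perm_inj _ s)) /=.
by apply: eq_bigr => i _; rewrite ffunE permK.
Qed.

Definition braket phi psi : C :=
  \sum_(x : {ffun 'I_n -> 'I_2}) (phi x)^* * psi x.

Definition pure_state psi : Prop := braket psi psi = 1.

Definition symmetric_state psi : Prop := forall s : 'S_n, perm_op s psi = psi.

End QubitSystems.

Section Pauli.
Variable C : numClosedFieldType.

Definition mx22 (a b c d : C) : 'M[C]_2 :=
  \matrix_(i < 2, j < 2)
    if i == 0 then (if j == 0 then a else b) else (if j == 0 then c else d).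

Definition pauli (a : 'I_4) : 'M[C]_2 :=
  match val a with
  | 0 => 1%:M
  | 1 => mx22 0 1
              1 0
  | 2 => mx22 0 (- 'i)
              'i 0
  | _ => mx22 1 0
              0 (- 1)
  end.

Definition bloch (n : nat) (psi : qvec C n) (alpha : {ffun 'I_n -> 'I_4}) : C :=
  (2 ^+ n)^-1 * braket psi (tens_op (fun i => pauli (alpha i)) psi).

End Pauli.

Definition weight (n : nat) (alpha : {ffun 'I_n -> 'I_4}) : nat :=
  #|[set i | alpha i != 0]|.

Definition multiplicity (n : nat) (alpha : {ffun 'I_n -> 'I_4}) (a : 'I_4)
  : nat := #|[set i | alpha i == a]|.

Definition even_index (n : nat) (alpha : {ffun 'I_n -> 'I_4}) : Prop :=
  forall a : 'I_4, a != 0 -> ~~ odd (multiplicity alpha a).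

(* Main.v *)
Require Import Defs.
From mathcomp Require Import all_boot all_order all_fingroup all_algebra.
From mathcomp Require Import reals complex.
From mathcomp Require Import ring.
Import GRing.Theory Num.Theory.
Local Open Scope ring_scope.

(** On two qubits [\sum_a sigma_a (x) sigma_a], the sum including [a = 0], is
    twice the swap operator, which fixes symmetric states.  Hence, if [alpha]
    vanishes at two positions [p] and [q], the expectations obtained by placing
    the same nontrivial Pauli matrix at [p] and [q] add up to the expectation
    of [sigma_alpha]; so if the latter is nonzero, one of the three is nonzero
    too.  Starting from [alpha = 0], every even weight is reached by adding such
    pairs, which preserves evenness. *)

Section PairInsertion.
Context {n : nat}.
Implicit Types (alpha : {ffun 'I_n -> 'I_4}) (p q : 'I_n) (a b : 'I_4).

Definition set_pair alpha p q a : {ffun 'I_n -> 'I_4} :=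
  [ffun i => if (i == p) || (i == q) then a else alpha i].

Lemma set_pair0 alpha p q :
  alpha p = 0 -> alpha q = 0 -> set_pair alpha p q 0 = alpha.
Proof.
move=> p0 q0; apply/ffunP=> i; rewrite ffunE.
by case: eqP => [->|_] //=; case: eqP => [->|].
Qed.

(** Stated for a general [P] so as to cover both the weight ([P] is being nonzero) and each
    multiplicity ([P] is being equal to a fixed nonzero [b]). Both new positions contribute [P a],
    so the parity is kept. *)
Lemma card_set_pair (P : pred 'I_4) alpha p q a : p != q ->
  ~~ P (alpha p) -> ~~ P (alpha q) ->
  #|[set i | P (set_pair alpha p q a i)]| =
    ((P a).*2 + #|[set i | P (alpha i)]|)%N.
Proof.
move=> pq Pp Pq; case Pa: (P a).
  have -> : [set i | P (set_pair alpha p q a i)] =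
            p |: (q |: [set i | P (alpha i)]).
    apply/setP=> i; rewrite !inE ffunE orbA.
    by case: ((i == p) || (i == q)).
  by rewrite !cardsU1 !inE (negbTE pq) (negbTE Pp) (negbTE Pq).
rewrite add0n; apply: eq_card => i; rewrite !inE ffunE.
case: eqP => [->|_] /=; first by rewrite Pa (negbTE Pp).
by case: eqP => [->|//]; rewrite Pa (negbTE Pq).
Qed.

Lemma weight_set_pair alpha p q a : p != q -> alpha p = 0 -> alpha q = 0 ->
  a != 0 -> weight (set_pair alpha p q a) = (weight alpha).+2.
Proof.
move=> pq p0 q0 a0.
by rewrite /weight (card_set_pair (fun b => b != 0)) ?p0 ?q0 // a0.
Qed.

Lemma even_set_pair alpha p q a : p != q -> alpha p = 0 -> alpha q = 0 ->
  even_index alpha -> even_index (set_pair alpha p q a).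
Proof.
move=> pq p0 q0 ev b b0; have b0' : 0 != b by rewrite eq_sym.
rewrite /multiplicity (card_set_pair (fun c => c == b)) ?p0 ?q0 //.
by rewrite oddD odd_double; exact: ev.
Qed.

End PairInsertion.

Section Expectation.
Variable C : numClosedFieldType.

(** Twice the swap operator, entry by entry: row [(x1, x2)], column [(y1, y2)]. All sixteen entries
    are checked. *)
Lemma sum_pauli_pauli (x1 x2 y1 y2 : 'I_2) :
  \sum_(a : 'I_4) pauli C a x1 y1 * pauli C a x2 y2 =
  2 * ((x1 == y2)%:R * (x2 == y1)%:R).
Proof.
have i2 : 'i * 'i = -1 :> C by rewrite -expr2 sqrCi.
rewrite !big_ord_recl big_ord0 /pauli /= !mxE.
case: x1 => [[|[|//]] ?]; case: x2 => [[|[|//]] ?];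
  case: y1 => [[|[|//]] ?]; case: y2 => [[|[|//]] ?] /=;
  rewrite ?mulNr ?mulrN ?i2; ring.
Qed.

(** The Bloch component without its nonzero factor [2^-n], which does not affect vanishing. *)
Definition expectation {n} (psi : qvec C n) (alpha : {ffun 'I_n -> 'I_4}) : C :=
  braket psi (tens_op (fun i => pauli C (alpha i)) psi).

Variables (n : nat) (psi : qvec C n).
Implicit Types (alpha : {ffun 'I_n -> 'I_4}) (p q : 'I_n).

Lemma expectation0 : expectation psi [ffun=> 0] = braket psi psi.
Proof.
congr braket; apply/ffunP=> x; rewrite ffunE (bigD1 x) //= [X in _ + X]big1 ?addr0.
  by rewrite big1 ?mul1r // => i _; rewrite ffunE /pauli /= mxE eqxx.
move=> y /eqP yx.
have [i xy] : exists i, x i != y i.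
  apply/existsP; apply: contra_notT yx; rewrite negb_exists => /forallP xy.
  by apply/ffunP=> i; move: (xy i); rewrite negbK => /eqP.
by rewrite (bigD1 i) //= ffunE /pauli /= mxE (negbTE xy) !mul0r.
Qed.

Hypothesis psi_sym : symmetric_state psi.

Lemma sum_tens_op_set_pair alpha p q x :
  p != q -> alpha p = 0 -> alpha q = 0 ->
  \sum_a tens_op (fun i => pauli C (set_pair alpha p q a i)) psi x =
  2 * tens_op (fun i => pauli C (alpha i)) psi x.
Proof.
move=> pq p0 q0.
have split_pair F : \prod_(i < n) F i =
    F p * F q * \prod_(i < n | (i != p) && (i != q)) F i :> C.
  by rewrite (bigD1 p) //= (bigD1 q) ?[q == p]eq_sym //= mulrA.
under eq_bigr do rewrite ffunE.
rewrite exchange_big /= ffunE mulr_sumr.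
(* Summing over [h y] instead of [y] leaves [psi] unchanged by symmetry and turns the swap entries
   at [p], [q] into identity entries, which are those of [alpha] there. *)
pose h (y : {ffun 'I_n -> 'I_2}) := [ffun i => y (tperm p q i)].
have hK : involutive h by move=> y; apply/ffunP=> i; rewrite !ffunE tpermK.
rewrite (reindex_inj (inv_inj hK)) /=; apply: eq_bigr => y _.
have -> : psi (h y) = psi y.
  by have /ffunP/(_ y) := psi_sym (tperm p q); rewrite ffunE.
rewrite -mulr_suml mulrA; congr (_ * _).
rewrite (split_pair (fun i => pauli C (alpha i) (x i) (y i))) p0 q0.
transitivity (\sum_(a : 'I_4) pauli C a (x p) (y q) * pauli C a (x q) (y p) *
    \prod_(i < n | (i != p) && (i != q)) pauli C (alpha i) (x i) (y i)).
  apply: eq_bigr => a _; rewrite split_pair !ffunE !eqxx orbT /= tpermL tpermR.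
  congr (_ * _); apply: eq_bigr => i /andP[ip iq].
  by rewrite !ffunE (negbTE ip) (negbTE iq) tpermD 1?eq_sym.
by rewrite -mulr_suml sum_pauli_pauli /pauli /= !mxE -mulrA.
Qed.

(** The sum over all four [a] is twice the right-hand side, and its term [a = 0] is one of these two
    copies. *)
Lemma sum_expectation_set_pair alpha p q :
  p != q -> alpha p = 0 -> alpha q = 0 ->
  \sum_(a | a != 0) expectation psi (set_pair alpha p q a) =
  expectation psi alpha.
Proof.
move=> pq p0 q0; apply: (addrI (expectation psi alpha)).
transitivity (\sum_a expectation psi (set_pair alpha p q a)).
  by rewrite [RHS](bigD1 (0 : 'I_4)) //= set_pair0.
rewrite /expectation /braket exchange_big -big_split; apply: eq_bigr => x _ /=.
by rewrite -mulr_sumr sum_tens_op_set_pair // mulr_natl mulr2n mulrDr.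
Qed.

(** Induction on [k]. The vanishing of [alpha] from position [k.*2] on is carried along so that
    positions [k.*2] and [k.*2.+1] are free for the next pair. *)
Lemma exists_even_expectation_neq0 k : braket psi psi != 0 -> (k.*2 <= n)%N ->
  exists alpha, [/\ even_index alpha, weight alpha = k.*2,
    forall i : 'I_n, (k.*2 <= i)%N -> alpha i = 0 & expectation psi alpha != 0].
Proof.
move=> psi0; elim: k => [_|k IHk].
  exists [ffun=> 0]; split=> [a a0||i _|]; rewrite ?expectation0 ?ffunE //.
    rewrite /multiplicity (_ : [set _ | _] = set0) ?cards0 //.
    by apply/setP=> i; rewrite !inE ffunE eq_sym (negbTE a0).
  rewrite /weight (_ : [set _ | _] = set0) ?cards0 //.
  by apply/setP=> i; rewrite !inE ffunE eqxx.
rewrite doubleS => lt_k1n; have lt_kn := ltnW lt_k1n.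
have [alpha [ev wt al0 Ealpha]] := IHk (ltnW lt_kn).
pose p := Ordinal lt_kn; pose q := Ordinal lt_k1n.
have pq : p != q by rewrite -val_eqE /= neq_ltn ltnSn.
have p0 : alpha p = 0 by apply: al0 => /=.
have q0 : alpha q = 0 by apply: al0 => /=.
have [a a0 Ea] : exists2 a, a != 0 & expectation psi (set_pair alpha p q a) != 0.
  apply/exists_inP; apply: contraNT Ealpha.
  rewrite negb_exists_in => /forall_inP E0.
  rewrite -(sum_expectation_set_pair alpha p q pq p0 q0) big1 // => a /E0.
  by rewrite negbK => /eqP.
exists (set_pair alpha p q a); split=> //.
- exact: even_set_pair.
- by rewrite weight_set_pair // wt.
- move=> i ki; rewrite ffunE -!val_eqE /= !gtn_eqF ?(ltnW ki) //=.
  exact/al0/ltnW/ltnW.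
Qed.

End Expectation.

Theorem theorem3 (R : realType) (n : nat) (hn : (1 <= n)%N)
  (psi : qvec R[i] n) (psi_pure : pure_state psi)
  (psi_sym : symmetric_state psi)
  (w : nat) (w_even : ~~ odd w) (w_le : (w <= n)%N) :
  exists alpha : {ffun 'I_n -> 'I_4},
    [/\ even_index alpha, weight alpha = w & bloch psi alpha <> 0].
Proof.
have psi0 : braket psi psi != 0 by rewrite psi_pure oner_neq0.
rewrite -(even_halfK w_even) in w_le *.
have [alpha [ev wt _ Ealpha]] :=
  exists_even_expectation_neq0 _ _ psi psi_sym _ psi0 w_le.
exists alpha; split=> //; apply/eqP.
by rewrite mulf_neq0 // invr_eq0 expf_neq0 // pnatr_eq0.
Qed.
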